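(* Let $(\Omega,\mathcal F,\mathbf P,\{\mathcal F_t\}_{t\ge 0})$ be a filtered probability space and let $Z=(Z_t)_{t\ge 0}$ be a Lévy process in $\mathbf R^d$ starting from the origin and adapted to $\{\mathcal F_t\}$. Assume that $Z$ has a probability density $p(t,x)$ with respect to the Lebesgue measure of $\mathbf R^d$, i.e. $\mathbf P(Z_t\in dx)=p(t,x)\,dx$. Assume moreover that $$\mathbf P\bigl(p(s,Z_t)>0 \text{ for all } s>0 \text{ and all } t>0\bigr)=1,$$ and that for all $t,s>0$ the function $p(t,\cdot)\,p(s,\cdot)$ is integrable with respect to the Lebesgue measure on $\mathbf R^d$. Let $\lambda:[0,\infty)\to[0,\infty)$ be a continuous function. Then the term structure model given by $$P_t^T=\frac{p(\lambda_T+T-t,\,Z_t)}{p(\lambda_t,\,Z_t)},\qquad 0\le t\le T<\infty,$$ is arbitrage-free in the state price density sense, with state price density $\pi_t=p(\lambda_t,Z_t)$; that is, $$P_t^T=\pi_t^{-1}\,\mathbf E^{\mathbf P}[\pi_T\mid\mathcal F_t],\qquad 0\le t\le T<\infty.$$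
   Context: $P_t^T$ denotes the market value at time $t$ of the zero-coupon bond with maturity $T$. A strictly positive process $\{\pi_t\}$ on the filtered probability space $(\Omega,\mathcal F,\mathbf P,\{\mathcal F_t\})$ is a state price density for the bond market $\{P_t^T\}_{0\le t\le T}$ if $P_t^T=\pi_t^{-1}\,\mathbf E^{\mathbf P}[\pi_T\mid\mathcal F_t]$ for all $0\le t\le T$. The model is called arbitrage-free in the state price density sense if such a process $\pi$ exists. Here $\lambda_t$ denotes $\lambda(t)$.
   Formalization: Adds that p(t,·) is even (the claim fails for Brownian motion with drift) and continuous (values at Z_0=0 matter); increments of Z are independent of F_s; dates are restricted to those with λ_t>0, since p(0,·) does not exist. *)

(* Defs.v *)
From HB Require Import structures.
From mathcomp Require Import all_boot all_order all_algebra.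
From mathcomp Require Import all_classical all_reals all_analysis.
Set Implicit Arguments.
Unset Strict Implicit.
Unset Printing Implicit Defensive.
Import Order.TTheory GRing.Theory Num.Theory.
Import numFieldNormedType.Exports.
Local Open Scope classical_set_scope.
Local Open Scope ring_scope.

Fact rV_display : measure_display.
Proof. exact: default_measure_display. Qed.

Section rV_measurable.
Context {R : realType}.
Variable d : nat.

(* The coordinate projections generate the Borel sigma-algebra of R^d. *)
Let coord (i : 'I_d) (x : 'rV[R]_d) : R := x ord0 i.

Let rV_set0 : g_sigma_preimage coord set0.
Proof. exact: sigma_algebra0. Qed.

Let rV_setC A : g_sigma_preimage coord A -> g_sigma_preimage coord (~` A).
Proof. exact: sigma_algebraC. Qed.

Let rV_bigcup (F : (set 'rV[R]_d)^nat) :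
  (forall i, g_sigma_preimage coord (F i)) ->
  g_sigma_preimage coord (\bigcup_i (F i)).
Proof. exact: sigma_algebra_bigcup. Qed.

HB.instance Definition _ := @isMeasurable.Build rV_display
  'rV[R]_d (g_sigma_preimage coord) rV_set0 rV_setC rV_bigcup.
End rV_measurable.

Section rV_measurable_lemmas.
Context {R : realType}.

Lemma measurable_coord n (i : 'I_n) :
  measurable_fun [set: 'rV[R]_n] (fun x : 'rV[R]_n => x ord0 i).
Proof.
move=> _ Y mY; rewrite setTI; apply: sub_sigma_algebra => /=.
rewrite -bigcup_seq/=; exists i => /=; first by rewrite mem_index_enum.
by exists Y => //; rewrite setTI.
Qed.

Lemma measurable_fun_rVP d (T : measurableType d) n (f : T -> 'rV[R]_n) :
  measurable_fun [set: T] f <->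
  forall i, measurable_fun [set: T] (fun t => f t ord0 i).
Proof.
split=> [mf i|mf].
  by apply: (measurableT_comp (measurable_coord i) mf).
rewrite /measurable_fun => _ Y; rewrite setTI.
have /(_ Y) : @measurable _ 'rV[R]_n `<=`
    [set B | measurable (f @^-1` B)]; last exact.
apply: smallest_sub.
  split=> [|B /= mB|F /= mF].
  - by rewrite /= preimage_set0.
  - by rewrite setTD preimage_setC; exact: measurableC.
  - by rewrite preimage_bigcup; exact: bigcupT_measurable.
rewrite -bigcup_seq => B [i _ [C mC <-]] /=.
by have := mf i measurableT C mC; rewrite !setTI.
Qed.

End rV_measurable_lemmas.

Lemma sigma_finite_product d1 d2 (T1 : measurableType d1)
    (T2 : measurableType d2) (R : realType)
    (m1 : {sigma_finite_measure set T1 -> \bar R})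
    (m2 : {sigma_finite_measure set T2 -> \bar R}) :
  sigma_finite setT (m1 \x m2)%E.
Proof.
have /sigma_finiteP[F [TF ndF Foo]] := sigma_finiteT m1.
have /sigma_finiteP[G [TG ndG Goo]] := sigma_finiteT m2.
exists (fun n => F n `*` G n).
  rewrite -setXTT TF TG predeqE => -[x y]; split.
    move=> [/= [n _ Fnx] [k _ Gky]]; exists (maxn n k) => //; split.
    - by move: x Fnx; exact/subsetPset/ndF/leq_maxl.
    - by move: y Gky; exact/subsetPset/ndG/leq_maxr.
  by move=> [n _ []/= ? ?]; split; exists n.
move=> k; have [? ?] := Foo k; have [? ?] := Goo k.
split; first exact: measurableX.
by rewrite product_measure1E// lte_mul_pinfty// ge0_fin_numE.
Qed.

Section rV_lebesgue.
Context {R : realType}.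

Definition rV_cons n (xv : measurableTypeR R * 'rV[R]_n) : 'rV[R]_n.+1 :=
  row_mx (const_mx xv.1 : 'rV[R]_1) xv.2.

Definition rV_uncons n (v : 'rV[R]_n.+1) : measurableTypeR R * 'rV[R]_n :=
  (v ord0 ord0, \row_i v ord0 (lift ord0 i)).

Lemma rV_cons0 n (xv : measurableTypeR R * 'rV[R]_n) :
  rV_cons xv ord0 ord0 = xv.1.
Proof. by rewrite mxE; case: splitP => // j _; rewrite mxE. Qed.

Lemma rV_consS n (xv : measurableTypeR R * 'rV[R]_n) (i : 'I_n) :
  rV_cons xv ord0 (lift ord0 i) = xv.2 ord0 i.
Proof.
rewrite mxE; case: splitP => k; first by rewrite ord1 lift0.
by rewrite lift0 add1n => /succn_inj/ord_inj ->.
Qed.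

Lemma rV_consK n : cancel (@rV_cons n) (@rV_uncons n).
Proof.
move=> [x v]; rewrite /rV_uncons rV_cons0; congr (_, _).
by apply/rowP => i; rewrite mxE rV_consS.
Qed.

Lemma rV_unconsK n : cancel (@rV_uncons n) (@rV_cons n).
Proof.
move=> v; apply/rowP => i; have [j ->|->] := unliftP ord0 i.
  by rewrite rV_consS mxE.
by rewrite rV_cons0.
Qed.

Lemma measurable_rV_cons n : measurable_fun setT (@rV_cons n).
Proof.
apply/measurable_fun_rVP => i; have [j ->|->] := unliftP ord0 i.
  under eq_fun do rewrite rV_consS.
  exact: measurableT_comp (measurable_coord j) measurable_snd.
by under eq_fun do rewrite rV_cons0; exact: measurable_fst.
Qed.

Lemma measurable_rV_uncons n : measurable_fun setT (@rV_uncons n).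
Proof.
apply: measurable_fun_pair; first exact: measurable_coord.
apply/measurable_fun_rVP => i.
by under eq_fun do rewrite mxE; exact: measurable_coord.
Qed.

Section step.
Variables (n : nat) (mu : {sigma_finite_measure set 'rV[R]_n -> \bar R}).

Definition rV_lebesgue_step : set 'rV[R]_n.+1 -> \bar R :=
  pushforward (@lebesgue_measure R \x mu)%E (@rV_cons n).

Let step0 : rV_lebesgue_step set0 = 0%E.
Proof. by rewrite /rV_lebesgue_step /pushforward preimage_set0 measure0. Qed.

Let step_ge0 A : (0 <= rV_lebesgue_step A)%E.
Proof.
rewrite /rV_lebesgue_step /pushforward; exact: measure_ge0. Qed.

Let step_sigma_additive : semi_sigma_additive rV_lebesgue_step.
Proof.
move=> F mF tF mUF; rewrite /rV_lebesgue_step /pushforward preimage_bigcup.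
apply: measure_semi_sigma_additive.
- by move=> k; rewrite -[X in measurable X]setTI; exact: measurable_rV_cons.
- apply/trivIsetP => /= i j _ _ ij; rewrite -preimage_setI.
  by move/trivIsetP : tF => /(_ _ _ _ _ ij) ->//; rewrite preimage_set0.
- rewrite -preimage_bigcup -[X in measurable X]setTI.
  exact: measurable_rV_cons.
Qed.

HB.instance Definition _ := isMeasure.Build _ _ _
  rV_lebesgue_step step0 step_ge0 step_sigma_additive.

Let rV_lebesgue_step_sigma_finite : sigma_finite setT rV_lebesgue_step.
Proof.
have [F FT mF] := sigma_finite_product (@lebesgue_measure R) mu.
exists (fun k => (@rV_uncons n) @^-1` F k).
  by rewrite -preimage_bigcup -FT preimage_setT.
move=> k; have [mFk Fk] := mF k; split.
  by rewrite -[X in measurable X]setTI; exact: measurable_rV_uncons.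
rewrite /rV_lebesgue_step /pushforward -comp_preimage.
rewrite (_ : _ \o _ = id) ?preimage_id//.
by apply/funext => x; exact: rV_consK.
Qed.

HB.instance Definition _ := Measure_isSigmaFinite.Build _ _ _
  rV_lebesgue_step rV_lebesgue_step_sigma_finite.
End step.

Fixpoint rV_lebesgue n : {sigma_finite_measure set 'rV[R]_n -> \bar R} :=
  match n with
  | 0 => @dirac _ 'rV[R]_0 0 R
  | m.+1 => rV_lebesgue_step (rV_lebesgue m)
  end.

Lemma rV_lebesgue_box n (a b : 'rV[R]_n) : (forall i, a ord0 i <= b ord0 i) ->
  rV_lebesgue n [set x : 'rV[R]_n | forall i, x ord0 i \in `]a ord0 i, b ord0 i]] =
  (\prod_(i < n) (b ord0 i - a ord0 i))%:E.
Proof.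
elim: n a b => [|n IH] a b ab.
  by rewrite big_ord0 /= diracE mem_set//= => -[].
rewrite /= /rV_lebesgue_step /pushforward.
set a' := (@rV_uncons n a).2; set b' := (@rV_uncons n b).2.
rewrite (_ : _ @^-1` _ = `]a ord0 ord0, b ord0 ord0] `*`
  [set x : 'rV[R]_n | forall i, x ord0 i \in `]a' ord0 i, b' ord0 i]]); last first.
  apply/seteqP; split=> [xv /= h|xv /= [hx hv] i].
    split; first by have := h ord0; rewrite rV_cons0.
    by move=> i; have := h (lift ord0 i); rewrite rV_consS !mxE.
  have [j ->|->] := unliftP ord0 i; last by rewrite rV_cons0.
  by have := hv j; rewrite rV_consS !mxE.
rewrite product_measure1E//; last first.
  rewrite (_ : [set _ | _] = \bigcap_(i in [set: 'I_n])
      ((fun x : 'rV[R]_n => x ord0 i) @^-1` [set` `]a' ord0 i, b' ord0 i]])).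
    apply: fin_bigcap_measurable => // i _.
    by rewrite -[X in measurable X]setTI; exact: measurable_coord.
  by apply/seteqP; split=> x /= h i; [move=> _; exact: h | exact: h].
rewrite IH; last by move=> i; rewrite /a' /b' !mxE.
have L : lebesgue_measure `]a ord0 ord0, b ord0 ord0]%classic =
    (b ord0 ord0 - a ord0 ord0)%:E.
  rewrite lebesgue_measure_itv/= lte_fin; case: ltP => [_|ba].
    by rewrite -EFinB.
  have -> : b ord0 ord0 = a ord0 ord0 by apply/eqP; rewrite eq_le ba ab.
  by rewrite subrr.
apply: etrans (congr1 (fun z => z * _)%E L) _.
rewrite -EFinM big_ord_recl; congr (_ * _)%:E.
by apply: eq_bigr => i _; rewrite /a' /b' !mxE.
Qed.

End rV_lebesgue.
Arguments rV_lebesgue {R} n.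

Section bond_market.
Context {R : realType} {disp : measure_display} {Omega : measurableType disp}.
Variables (P : probability Omega R) (F : R -> set_system Omega).

Definition filtration : Prop :=
  [/\ forall t : R, 0 <= t -> sigma_algebra setT (F t),
      forall t : R, 0 <= t -> F t `<=` measurable &
      forall s t : R, 0 <= s -> s <= t -> F s `<=` F t].

Definition adapted_on (D : set R) {disp' : measure_display}
    {E : measurableType disp'} (X : R -> Omega -> E) : Prop :=
  forall t, D t -> forall B, measurable B -> F t (X t @^-1` B).

(* Levy process relative to the filtration: the increment after time s is
   independent of F s, not merely of the past of Z. *)
Definition levy_process {d : nat} (Z : R -> Omega -> 'rV[R]_d) : Prop :=
  [/\ adapted_on [set t : R | 0 <= t] Z,
      {ae P, forall w, Z 0 w = 0},
      forall s t : R, 0 <= s -> s <= t ->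
        forall (A : set Omega) (B : set 'rV[R]_d), F s A -> measurable B ->
          P (A `&` (Z t \- Z s) @^-1` B) =
          (P A * P ((Z t \- Z s)%R @^-1` B))%E,
      forall s t : R, 0 <= s -> s <= t ->
        forall B : set 'rV[R]_d, measurable B ->
          P ((Z t \- Z s) @^-1` B) = P (Z (t - s) @^-1` B) &
      forall t e : R, 0 <= t -> 0 < e ->
        P [set w | e <= `|Z s w - Z t w|] @[s --> within [set s : R | 0 <= s] (nbhs t)]
          --> 0%E].

Definition has_density {d : nat} (X : Omega -> 'rV[R]_d) (f : 'rV[R]_d -> R) :
    Prop :=
  [/\ measurable_fun setT f, forall x, 0 <= f x &
      forall A, measurable A ->
        P (X @^-1` A) = (\int[rV_lebesgue d]_(x in A) (f x)%:E)%E].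

(* Y is a version of the conditional expectation of X given the
   sigma-algebra G. *)
Definition is_cond_exp (G : set_system Omega) (X Y : Omega -> R) : Prop :=
  [/\ forall B : set R, measurable B -> G (Y @^-1` B),
      P.-integrable setT (EFin \o Y) &
      forall A, G A ->
        (\int[P]_(w in A) (Y w)%:E = \int[P]_(w in A) (X w)%:E)%E].

(* D is the set of dates of the market: [0, +oo[, or those dates at which the
   model is defined. Equalities between random variables are almost sure. *)
Definition state_price_density (D : set R) (bond : R -> R -> Omega -> R)
    (pi : R -> Omega -> R) : Prop :=
  [/\ adapted_on D pi,
      {ae P, forall w, forall t, D t -> 0 < pi t w} &
      forall t T, D t -> D T -> t <= T ->
        P.-integrable setT (EFin \o pi T) /\
        exists2 Y, is_cond_exp (F t) (pi T) Y &
          {ae P, forall w, bond t T w = (pi t w)^-1 * Y w}].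

Definition arbitrage_free (D : set R) (bond : R -> R -> Omega -> R) : Prop :=
  exists pi, state_price_density D bond pi.

End bond_market.

(* Main.v *)
Require Import Defs.
From HB Require Import structures.
From mathcomp Require Import all_boot all_order all_algebra.
From mathcomp Require Import all_classical all_reals all_analysis.
From mathcomp Require Import measurable_realfun ring lra.
Set Implicit Arguments.
Unset Strict Implicit.
Unset Printing Implicit Defensive.
Import Order.TTheory GRing.Theory Num.Theory.
Import numFieldNormedType.Exports.
Local Open Scope classical_set_scope.
Local Open Scope ring_scope.

(** Fix [s, r > 0].  Since [Z] has stationary increments that are independent
    of the past, [Z (t + r)] given [F t] is distributed as [Z t] plus an
    independent copy of [Z r], so that
      E[p s (Z (t + r)) | F t] = [x |-> \int p s (x + y) p r y dy] at [Z t]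
    ([levy_markov]).  As the densities are even, the function of [x] on the
    right is the convolution of [p s] and [p r], that is, a density of
    [Z (s + r)], and the conditional expectation is [p (s + r) (Z t)].  Taking
    [s = lambda T] and [r = T - t] gives the numerator of the bond price, and
    dividing by [p (lambda t) (Z t)] gives the pricing formula.

    The delicate point is that the law of [Z (s + r)] only determines the
    convolution almost everywhere ([chapman_kolmogorov_ae]), which says nothing
    at the single point [0] occupied by [Z 0].  The date [t = 0] therefore
    needs the Chapman-Kolmogorov identity at every point.  It holds because the
    densities are continuous and square integrable
    ([convolution_continuous_version]): Fatou's lemma along a sequence of points
    where the identity is known, applied to the integrands
    [f (x - y) * g y] and [(f (x - y) - g y) ^+ 2], bounds the convolution at
    the limit point from above and from below; the second bound uses that
    [\int f (x - y) ^+ 2 dy] does not depend on [x].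

    Evaluated at the origin the identity yields
      [p s 0 = E[p (s / 2) (Z (s / 2))]],
    which is positive because [p (s / 2) (Z (s / 2))] is almost surely positive;
    hence the state price density is positive at date [0] too. *)

(** * Reflection and translation invariance of Lebesgue measure on [R^n] *)

(** A [measure] structure on a push-forward depends on a proof that the map is
    measurable, which unification cannot find; it is passed explicitly here. *)
Definition pushforward_measure d1 d2 (T1 : measurableType d1)
    (T2 : measurableType d2) (R : realType) (m : {measure set T1 -> \bar R})
    (f : T1 -> T2) (mf : measurable_fun [set: T1] f) :
    {measure set T2 -> \bar R} :=
  measure_function_pushforward__canonical__measure_function_Measure m mf.

Lemma measurable_reflect (R : realType) (x : R) :
  measurable_fun [set: measurableTypeR R]
    (fun y : measurableTypeR R => x - y : measurableTypeR R).
Proof.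
exact: (@measurable_funB _ (measurableTypeR R) R setT (cst x) idfun
  (measurable_cst _) (@measurable_id _ (measurableTypeR R) setT)).
Qed.

Lemma lebesgue_measure_reflect (R : realType) (x : R)
    (A : set (measurableTypeR R)) : measurable A ->
  lebesgue_measure ((fun y : measurableTypeR R => x - y) @^-1` A) =
  lebesgue_measure A.
Proof.
have mf := @measurable_reflect R x.
move=> mA; apply/esym.
apply: (@lebesgue_measure_unique _
  (pushforward_measure lebesgue_measure mf)) => //= _ [[a b]] _ <-.
rewrite /pushforward_measure/= /pushforward /=.
have -> : (fun y : measurableTypeR R => x - y) @^-1` `]a, b] =
    `[x - b, x - a[%classic.
  apply/seteqP; split=> y /=; rewrite !in_itv/= => /andP[? ?];
    by apply/andP; split; lra.
rewrite /= !lebesgue_measure_itv/= !lte_fin ltrD2l ltrN2.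
by case: ifP => //; rewrite -!EFinD => _; congr (_%:E); lra.
Qed.

Lemma measurable_rV_add (R : realType) n d (T : measurableType d)
    (f g : T -> 'rV[R]_n) :
  measurable_fun setT f -> measurable_fun setT g ->
  measurable_fun setT (fun t => f t + g t).
Proof.
move=> /measurable_fun_rVP mf /measurable_fun_rVP mg.
apply/measurable_fun_rVP => i; under eq_fun do rewrite mxE.
exact: measurable_funD.
Qed.

Lemma measurable_rV_opp (R : realType) n d (T : measurableType d)
    (f : T -> 'rV[R]_n) :
  measurable_fun setT f -> measurable_fun setT (fun t => - f t).
Proof.
move=> /measurable_fun_rVP mf.
apply/measurable_fun_rVP => i; under eq_fun do rewrite mxE.
exact: measurableT_comp.
Qed.

Lemma measurable_rV_sub (R : realType) n d (T : measurableType d)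
    (f g : T -> 'rV[R]_n) :
  measurable_fun setT f -> measurable_fun setT g ->
  measurable_fun setT (fun t => f t - g t).
Proof.
by move=> mf mg; apply: measurable_rV_add => //; exact: measurable_rV_opp.
Qed.

(** [rV_lebesgue n.+1] is a product measure, and in the coordinates of
    [rV_cons] the reflection acts separately on both factors; as it preserves
    the measure of rectangles, it preserves the product measure. *)
Lemma rV_lebesgue_reflect (R : realType) n (x : 'rV[R]_n)
    (A : set 'rV[R]_n) : measurable A ->
  rV_lebesgue n ((fun y => x - y) @^-1` A) = rV_lebesgue n A.
Proof.
elim: n x A => [|n IH] x A mA.
  rewrite /= !diracE; do 3 congr (_ _).
  by apply/idP/idP; rewrite !inE /= (thinmx0 (x - 0)).
rewrite /= /rV_lebesgue_step /pushforward.
pose phi (uv : measurableTypeR R * 'rV[R]_n) : measurableTypeR R * 'rV[R]_n :=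
  (x ord0 ord0 - uv.1, (rV_uncons x).2 - uv.2).
have mphi : measurable_fun setT phi.
  apply: measurable_fun_pair.
    exact: measurableT_comp (measurable_reflect _) measurable_fst.
  by apply: measurable_rV_sub; [exact: measurable_cst|exact: measurable_snd].
have phiE uv : x - rV_cons uv = rV_cons (phi uv).
  apply/rowP => i; have [j ->|->] := unliftP ord0 i.
    by rewrite rV_consS [LHS]mxE [X in _ + X]mxE rV_consS /= !mxE.
  by rewrite rV_cons0 [LHS]mxE [X in _ + X]mxE rV_cons0.
have -> : @rV_cons R n @^-1` ((fun y => x - y) @^-1` A) =
    phi @^-1` (@rV_cons R n @^-1` A).
  by apply/seteqP; split=> uv; rewrite /preimage /= phiE.
have mA' : measurable (@rV_cons R n @^-1` A).
  by rewrite -[X in measurable X]setTI; exact: measurable_rV_cons.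
apply/esym.
apply: (@product_measure_unique _ _ _ _ _ _ _
  (pushforward_measure (lebesgue_measure \x rV_lebesgue n) mphi)%E)
  => // B C mB mC /=.
rewrite /pushforward.
have -> : phi @^-1` (B `*` C) =
    ((fun y : measurableTypeR R => x ord0 ord0 - y) @^-1` B) `*`
    ((fun y => (rV_uncons x).2 - y) @^-1` C) by [].
rewrite product_measure1E.
- congr (_ * _)%E; [exact: lebesgue_measure_reflect|exact: IH].
- rewrite -[X in measurable X]setTI; exact: measurable_reflect.
- rewrite -[X in measurable X]setTI.
  by apply: measurable_rV_sub => //; exact: measurable_cst.
Qed.

Lemma ge0_integral_rV_reflect (R : realType) n (x : 'rV[R]_n)
    (g : 'rV[R]_n -> \bar R) :
  measurable_fun setT g -> (forall y, 0 <= g y)%E ->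
  (\int[rV_lebesgue n]_y g (x - y)%R = \int[rV_lebesgue n]_y g y)%E.
Proof.
move=> mg g0.
have mphi : measurable_fun setT (fun y : 'rV[R]_n => x - y).
  by apply: measurable_rV_sub; [exact: measurable_cst|exact: measurable_id].
transitivity (\int[pushforward_measure (rV_lebesgue n) mphi]_y g y)%E.
  by rewrite /= ge0_integral_pushforward// preimage_setT.
by apply: eq_measure_integral => A mA _; exact: rV_lebesgue_reflect.
Qed.

(** A translation is the composition of two reflections. *)
Lemma ge0_integral_rV_translate (R : realType) n (x : 'rV[R]_n)
    (g : 'rV[R]_n -> \bar R) :
  measurable_fun setT g -> (forall y, 0 <= g y)%E ->
  (\int[rV_lebesgue n]_y g (x + y)%R = \int[rV_lebesgue n]_y g y)%E.
Proof.
move=> mg g0; rewrite -(ge0_integral_rV_reflect x mg g0).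
have mgx : measurable_fun setT (fun y : 'rV[R]_n => g (x - y)).
  apply: measurableT_comp => //.
  by apply: measurable_rV_sub; [exact: measurable_cst|exact: measurable_id].
rewrite -(ge0_integral_rV_reflect 0 mgx)//.
by apply: eq_integral => y _; rewrite sub0r opprK.
Qed.

(** * Integration against densities and laws of independent variables *)

(** The density [p] agrees almost everywhere with the Radon-Nikodym derivative
    of [nu], for which the change of variables is known. *)
Lemma ge0_integral_density d (T : measurableType d) (R : realType)
    (mu : {sigma_finite_measure set T -> \bar R})
    (nu : {finite_measure set T -> \bar R}) (p : T -> R) :
  measurable_fun setT p -> (forall x, 0 <= p x) ->
  (forall A, measurable A -> nu A = \int[mu]_(x in A) (p x)%:E)%E ->
  forall h : T -> \bar R, measurable_fun setT h -> (forall x, 0 <= h x)%E ->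
  (\int[nu]_x h x = \int[mu]_x (h x * (p x)%:E))%E.
Proof.
move=> mp p0 nuE h mh h0.
have mpE : measurable_fun setT (EFin \o p) by exact/measurable_EFinP.
have numu : nu `<< mu.
  apply/null_content_dominatesP => A mA A0; rewrite nuE//.
  by apply: null_set_integral => //; exact: measurable_funTS.
rewrite -(Radon_Nikodym_SigmaFinite.change_of_variables numu)//.
have fi := Radon_Nikodym_SigmaFinite.f_integrable numu.
have mf := measurable_int _ fi.
have f0 := Radon_Nikodym_SigmaFinite.f_ge0 numu.
apply: ge0_ae_eq_integral => //.
- exact: emeasurable_funM.
- exact: emeasurable_funM.
- by move=> x _; exact: mule_ge0.
- by move=> x _; rewrite mule_ge0// lee_fin.
- apply: ae_eqe_mul2l; apply: integral_ae_eq => // E _ mE.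
  by rewrite -nuE// (Radon_Nikodym_SigmaFinite.f_integral numu mE).
Qed.

(** The joint law of [X] and [Y] is the product of their laws, so this is
    Tonelli's theorem.  The variables take values in arbitrary measurable types
    so that [X] can be the identity map onto [Omega] equipped with a smaller
    sigma-algebra. *)
Lemma ge0_integral_indep d d1 d2 (Omega : measurableType d) (R : realType)
    (P : probability Omega R) (T1 : measurableType d1) (T2 : measurableType d2)
    (X : Omega -> T1) (Y : Omega -> T2)
    (mX : measurable_fun setT X) (mY : measurable_fun setT Y) :
  (forall A B, measurable A -> measurable B ->
    P (X @^-1` A `&` Y @^-1` B) = P (X @^-1` A) * P (Y @^-1` B))%E ->
  forall h : T1 * T2 -> \bar R,
    measurable_fun setT h -> (forall z, 0 <= h z)%E ->
  (\int[P]_w h (X w, Y w) = \int[P]_w \int[P]_v h (X w, Y v))%E.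
Proof.
move=> indep h mh h0.
pose X' : {mfun Omega >-> T1} := mfun_Sub (mem_set mX).
pose Y' : {mfun Omega >-> T2} := mfun_Sub (mem_set mY).
have mXY : measurable_fun setT (fun w => (X w, Y w)).
  exact: measurable_fun_pair.
have mh1 x : measurable_fun setT (fun y => h (x, y)).
  exact: measurableT_comp.
transitivity (\int[pushforward_measure P mXY]_z h z)%E.
  by rewrite /= ge0_integral_pushforward// preimage_setT.
transitivity (\int[distribution P X' \x distribution P Y']_z h z)%E.
  apply: eq_measure_integral => A mA _; apply/esym.
  by apply: product_measure_unique => // B C mB mC; exact: indep.
rewrite fubini_tonelli1// ge0_integral_pushforward//; last first.
- by move=> x _; apply: integral_ge0.
- exact: measurable_fun_fubini_tonelli_F.
rewrite preimage_setT; apply: eq_integral => w _ /=.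
by rewrite /fubini_F ge0_integral_pushforward// preimage_setT.
Qed.

(** * From almost everywhere to everywhere for convolutions *)

(** Every ball contains a box of positive measure, so a set of full Lebesgue
    measure is dense. *)
Lemma ae_rV_lebesgue_approx (R : realType) d (Q : 'rV[R]_d -> Prop)
    (x : 'rV[R]_d) :
  {ae rV_lebesgue d, forall y, Q y} ->
  exists2 u : nat -> 'rV[R]_d, u n @[n --> \oo] --> x & forall n, Q (u n).
Proof.
move=> [N [mN N0 QN]].
have approx (e : R) : 0 < e -> exists2 y, ball x e y & Q y.
  move=> e0; apply: contrapT => noy.
  pose a := (\row_i (x ord0 i - e / 2)) : 'rV[R]_d.
  pose b := (\row_i (x ord0 i + e / 2)) : 'rV[R]_d.
  have ab i : a ord0 i <= b ord0 i by rewrite !mxE; lra.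
  have mbox : measurable [set y : 'rV[R]_d |
      forall i, y ord0 i \in `]a ord0 i, b ord0 i]].
    rewrite (_ : [set _ | _] = \bigcap_(i in [set: 'I_d])
      ((fun y : 'rV[R]_d => y ord0 i) @^-1` [set` `]a ord0 i, b ord0 i]])).
      apply: fin_bigcap_measurable => // i _.
      by rewrite -[X in measurable X]setTI; exact: measurable_coord.
    by apply/seteqP; split=> y /= h i; [move=> _; exact: h | exact: h].
  have := rV_lebesgue_box ab.
  rewrite (subset_measure0 mbox mN _ N0); last first.
    move=> y /= ybox; apply: QN => /= Qy; apply: noy; exists y => //.
    split=> // i j.
    have := ybox j; rewrite (ord1 i) !mxE in_itv/= => /andP[ay yb].
    by rewrite /ball/= ltr_norml; apply/andP; split; lra.
  move=> [] /eqP; rewrite eq_sym prodf_seq_eq0 => /hasP[i _ /=].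
  by rewrite !mxE => /eqP; lra.
have /choice[u uP] : forall n : nat, exists y, ball x n.+1%:R^-1 y /\ Q y.
  move=> n; have [|y xy Qy] := approx n.+1%:R^-1; first by rewrite invr_gt0.
  by exists y.
exists u; last by move=> n; exact: (uP n).2.
apply/cvg_ballP => e e0; near=> n.
apply: le_ball (uP n).1; apply: ltW.
by near: n; exact: near_infty_natSinv_lt (PosNum e0).
Unshelve. all: by end_near. Qed.

(** Write [I m x] for the convolution and [I s x] for
    [\int (f (x - y) - g y) ^+ 2 dy].  Expanding the square and using reflection
    invariance, [I s x + 2 I m x] is a constant.  By Fatou's lemma both are
    lower semicontinuous along a sequence [u] tending to [x] on which the
    identity holds.  For [I m] this gives [I m x <= q x]; for [I s], whose
    values along [u] are the constant minus [2 q (u n)], it gives the converse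
    inequality. *)
Lemma convolution_continuous_version (R : realType) d
    (f g q : 'rV[R]_d -> R) :
  measurable_fun setT f -> measurable_fun setT g ->
  (forall x, 0 <= f x) -> (forall x, 0 <= g x) ->
  (rV_lebesgue d).-integrable setT (EFin \o (fun x => f x * f x)) ->
  (rV_lebesgue d).-integrable setT (EFin \o (fun x => g x * g x)) ->
  continuous f -> continuous q ->
  {ae rV_lebesgue d, forall x,
    (q x)%:E = (\int[rV_lebesgue d]_y (f (x - y)%R * g y)%:E)%E} ->
  forall x, (q x)%:E = (\int[rV_lebesgue d]_y (f (x - y)%R * g y)%:E)%E.
Proof.
move=> mf mg f0 g0 f2 g2 cf cq qae x.
have [u ux qu] := ae_rV_lebesgue_approx x qae.
pose mu := rV_lebesgue (R := R) d.
have mfx z : measurable_fun setT (fun y : 'rV[R]_d => f (z - y)).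
  apply: measurableT_comp => //.
  by apply: measurable_rV_sub; [exact: measurable_cst|exact: measurable_id].
pose I (h : R -> R -> R) (z : 'rV[R]_d) : \bar R :=
  (\int[mu]_y (h (f (z - y)%R) (g y))%:E)%E.
have limE (v : nat -> R) (l : R) : v n @[n --> \oo] --> l ->
    limn_einf (EFin \o v) = l%:E.
  move=> vl; apply: (cvg_limn_einf_sup _).1.
  by apply: cvg_EFin => //; exact: nearW.
have lsc (h : R -> R -> R) : (forall b, continuous (h^~ b)) ->
    (forall z y, 0 <= h (f (z - y)) (g y)) ->
    (forall z, measurable_fun setT (fun y : 'rV[R]_d => h (f (z - y)) (g y))) ->
    (I h x <= limn_einf (fun n => I h (u n)))%E.
  move=> ch h0 mh.
  have mhE n : measurable_fun setT
      (fun y : 'rV[R]_d => (h (f (u n - y)) (g y))%:E).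
    by apply/measurable_EFinP; exact: mh.
  have := fatou mu measurableT mhE (fun n y _ => h0 (u n) y).
  apply: le_trans; rewrite le_eqVlt; apply/orP; left; apply/eqP.
  apply: eq_integral => y _; apply/esym/limE.
  apply: (@continuous_cvg _ _ _ _ _ (fun n => f (u n - y)) (h^~ (g y))
    (f (x - y))); first exact: ch.
  apply: (@continuous_cvg _ _ _ _ _ (fun n => u n - y) f (x - y)).
    exact: cf.
  by apply: cvgB => //; exact: cvg_cst.
pose m (a b : R) := a * b.
pose s (a b : R) := (a - b) * (a - b).
have mm z : measurable_fun setT (fun y : 'rV[R]_d => m (f (z - y)) (g y)).
  exact: measurable_funM.
have ms z : measurable_fun setT (fun y : 'rV[R]_d => s (f (z - y)) (g y)).
  by apply: measurable_funM; exact: measurable_funB.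
have m0 z y : 0 <= m (f (z - y)) (g y) by exact: mulr_ge0.
have s0 z y : 0 <= s (f (z - y)) (g y) by rewrite /s -expr2 sqr_ge0.
have addE (y : \bar R) (r t : R) : (y + r%:E = t%:E -> y = (t - r)%:E)%E.
  by case: y => //= y [<-]; rewrite addrK.
have [a aE] : exists a, (\int[mu]_y (f y * f y)%:E = a%:E)%E.
  exists (fine (\int[mu]_y (f y * f y)%:E)).
  by rewrite fineK// integrable_fin_num.
have [b bE] : exists b, (\int[mu]_y (g y * g y)%:E = b%:E)%E.
  exists (fine (\int[mu]_y (g y * g y)%:E)).
  by rewrite fineK// integrable_fin_num.
have polarization z : (I s z + (I m z + I m z) = (a + b)%:E)%E.
  have mE (h k : 'rV[R]_d -> R) : measurable_fun setT h ->
      measurable_fun setT k -> measurable_fun setT (fun y => (h y * k y)%:E).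
    by move=> mh mk; apply/measurable_EFinP; exact: measurable_funM.
  have msE : measurable_fun setT (fun y : 'rV[R]_d => (s (f (z - y)) (g y))%:E).
    exact/measurable_EFinP.
  have mmE : measurable_fun setT (fun y : 'rV[R]_d => (m (f (z - y)) (g y))%:E).
    exact/measurable_EFinP.
  rewrite EFinD -aE -bE.
  rewrite -(ge0_integral_rV_reflect z (mE _ _ mf mf)); last first.
    by move=> y; rewrite lee_fin mulr_ge0.
  have pos (h : 'rV[R]_d -> R) : (forall y, 0 <= h y) ->
    forall y, setT y -> (0 <= (h y)%:E)%E by move=> h0 y _; rewrite lee_fin.
  have ff0 y : 0 <= f (z - y) * f (z - y) by rewrite mulr_ge0.
  have gg0 y : 0 <= g y * g y by rewrite mulr_ge0.
  rewrite /I -(ge0_integralD _ measurableT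
    (pos _ (m0 _)) mmE (pos _ (m0 _)) mmE).
  rewrite -(ge0_integralD _ measurableT (pos _ (s0 _)) msE)//; last 2 first.
  - by move=> y _; rewrite -EFinD lee_fin addr_ge0.
  - exact: emeasurable_funD.
  rewrite -(ge0_integralD _ measurableT (pos _ ff0) (mE _ _ (mfx z) (mfx z))
    (pos _ gg0) (mE _ _ mg mg)).
  apply: eq_integral => y _; rewrite -!EFinD; congr (_%:E).
  by rewrite /s /m; ring.
have qu_cvg : q (u n) @[n --> \oo] --> q x.
  by apply: continuous_cvg => //; exact: cq.
have Imq : (I m x <= (q x)%:E)%E.
  apply: le_trans (lsc m _ m0 mm) _.
    by move=> c y; apply: cvgM; [exact: cvg_id|exact: cvg_cst].
  rewrite (_ : (fun n => I m (u n)) = EFin \o (q \o u)).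
    by rewrite (limE _ _ qu_cvg).
  by apply/funext => n; rewrite /= qu.
have Isq : (I s x <= (a + b - (q x + q x))%:E)%E.
  apply: le_trans (lsc s _ s0 ms) _.
    by move=> c y; apply: cvgM; apply: cvgB;
      by [exact: cvg_id|exact: cvg_cst].
  rewrite (_ : (fun n => I s (u n)) =
      EFin \o (fun n => a + b - (q (u n) + q (u n)))).
    rewrite (limE _ (a + b - (q x + q x)))//.
    by apply: cvgB; [exact: cvg_cst|exact: cvgD].
  by apply/funext => n /=; apply: addE; rewrite EFinD qu polarization.
have : I m x \is a fin_num.
  rewrite ge0_fin_numE; first exact: le_lt_trans Imq (ltry _).
  by apply: integral_ge0 => y _; rewrite lee_fin.
move=> /fineK Imx; have := polarization x; rewrite -Imx -EFinD => /addE IsE.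
move: Imq Isq; rewrite IsE -Imx !lee_fin => h1 h2.
rewrite -[RHS]/(I m x) -Imx; congr (_%:E); apply/eqP; rewrite eq_le.
by apply/andP; split; lra.
Qed.

(** * The Markov property and the Chapman-Kolmogorov identity *)

Section levy.
Context (R : realType) (disp : measure_display) (Omega : measurableType disp).
Context (P : probability Omega R) (F : R -> set_system Omega) (d : nat).
Context (Z : R -> Omega -> 'rV[R]_d).
Context (F_filtration : filtration F) (Z_levy : levy_process P F Z).

Lemma adapted_measurable t : 0 <= t -> measurable_fun setT (Z t).
Proof.
have [_ Fm _] := F_filtration; have [Zad _ _ _ _] := Z_levy.
by move=> t0 _ B mB; rewrite setTI; apply: (Fm _ t0); exact: Zad.
Qed.

Let increment t r w := Z (t + r) w - Z t w.

Let measurable_increment t r : 0 <= t -> 0 <= r ->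
  measurable_fun setT (increment t r).
Proof.
move=> t0 r0; apply: measurable_rV_sub; apply: adapted_measurable => //.
exact: addr_ge0.
Qed.

(** Independence of the increment from the sigma-algebra [F t] is independence
    of two random variables, the increment and the identity map from [Omega] to
    [Omega] equipped with [F t]; for the latter both the indicator of [A] and
    [Z t] are measurable. *)
Lemma levy_markov t r (f : 'rV[R]_d -> R) (A : set Omega)
    (g : 'rV[R]_d -> \bar R) :
  0 <= t -> 0 < r -> has_density P (Z r) f -> F t A ->
  measurable_fun setT g -> (forall x, 0 <= g x)%E ->
  (\int[P]_(w in A) g (Z (t + r) w) =
   \int[P]_(w in A) \int[rV_lebesgue d]_y (g (Z t w + y)%R * (f y)%:E))%E.
Proof.
move=> t0 r0 [mf f0 fE] FA mg g0.
have [Fs Fm _] := F_filtration; have [Zad _ Zind Zst _] := Z_levy.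
have tr : t <= t + r by rewrite lerDl ltW.
have mW := measurable_increment t0 (ltW r0).
pose W : {mfun Omega >-> 'rV[R]_d} := mfun_Sub (mem_set mW).
pose OmegaF := g_sigma_algebraType (F t).
have FE (B : set OmegaF) : measurable B -> F t B.
  move=> mB; have : <<s F t >> B by exact: mB.
  by rewrite (sigma_algebra_id (Fs t t0)).
have mid : measurable_fun [set: Omega] (id : Omega -> OmegaF).
  by move=> _ B mB; rewrite setTI; apply: (Fm _ t0); exact: FE.
have mZ : measurable_fun [set: OmegaF] (Z t).
  by move=> _ B mB; rewrite setTI; apply: sub_sigma_algebra; exact: Zad.
have mA : measurable (A : set OmegaF) by exact: sub_sigma_algebra.
pose h (z : OmegaF * 'rV[R]_d) : \bar R :=
  ((\1_A z.1)%:E * g (Z t z.1 + z.2)%R)%E.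
have h0 z : (0 <= h z)%E by rewrite mule_ge0// lee_fin.
have mh : measurable_fun setT h.
  apply: emeasurable_funM.
    apply/measurable_EFinP; apply: (measurableT_comp _ measurable_fst).
    exact: measurable_indic.
  apply: measurableT_comp => //; apply: measurable_rV_add.
    exact: measurableT_comp mZ measurable_fst.
  exact: measurable_snd.
have indep B C : measurable B -> measurable C ->
    (P ((id : Omega -> OmegaF) @^-1` B `&` W @^-1` C) =
     P ((id : Omega -> OmegaF) @^-1` B) * P (W @^-1` C))%E.
  by move=> mB mC; exact: (Zind _ _ t0 tr _ _ (FE _ mB) mC).
have lawW C : measurable C ->
    distribution P W C = (\int[rV_lebesgue d]_(x in C) (f x)%:E)%E.
  move=> mC; rewrite -fE// /distribution /pushforward.
  by rewrite [LHS]Zst// addrAC subrr add0r.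
have intA (k : Omega -> \bar R) :
    (\int[P]_(w in A) k w = \int[P]_w ((\1_A w)%:E * k w))%E.
  rewrite integral_mkcond; apply: eq_integral => w _.
  by rewrite patchE indicE; case: ifP; rewrite ?mul1e ?mul0e.
rewrite !intA.
have := ge0_integral_indep mid mW indep mh h0.
rewrite [X in X = _ -> _](_ : _ =
    \int[P]_w ((\1_A w)%:E * g (Z (t + r) w)))%E; last first.
  by apply: eq_integral => w _; rewrite /h/= /increment addrC subrK.
move=> ->; apply: eq_integral => w _.
have mgw : measurable_fun setT (fun y : 'rV[R]_d => g (Z t w + y)).
  apply: measurableT_comp => //; apply: measurable_rV_add => //.
rewrite /h/= ge0_integralZl_EFin//; last exact: measurableT_comp mgw mW.
congr (_ * _)%E.
rewrite -(ge0_integral_density mf f0 lawW mgw)//.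
by rewrite ge0_integral_distribution.
Qed.

(** Both sides are densities of [Z (s + r)]: by the Markov property at date [s]
    its law integrates the indicator of [E] at [x + y] against
    [fs x * fr y], and the translation [z = x + y] turns this into the integral
    of the convolution over [E]. *)
Lemma chapman_kolmogorov_ae s r (fs fr fsr : 'rV[R]_d -> R) :
  0 < s -> 0 < r -> has_density P (Z s) fs -> has_density P (Z r) fr ->
  has_density P (Z (s + r)) fsr ->
  {ae rV_lebesgue d, forall x,
    (fsr x)%:E = (\int[rV_lebesgue d]_y (fs (x - y) * fr y)%:E)%E}.
Proof.
move=> s0 r0 [mfs fs0 fsE] pr [mfsr fsr0 fsrE]; have [mfr fr0 _] := pr.
have [Fs _ _] := F_filtration.
have mZ := adapted_measurable (ltW s0).
have mZsr : measurable_fun setT (Z (s + r)).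
  by apply: adapted_measurable; rewrite addr_ge0 ?ltW.
pose mu := rV_lebesgue (R := R) d.
pose conv (x : 'rV[R]_d) : \bar R := (\int[mu]_y (fs (x - y)%R * fr y)%:E)%E.
(* the integrand in the coordinates (y, z), where z = x + y *)
pose G (E : set 'rV[R]_d) (yz : 'rV[R]_d * 'rV[R]_d) : \bar R :=
  (\1_E yz.2 * (fs (yz.2 - yz.1) * fr yz.1))%:E.
have G0 E yz : (0 <= G E yz)%E by rewrite lee_fin !mulr_ge0.
have mdiff : measurable_fun setT (fun yz : 'rV[R]_d * 'rV[R]_d => yz.2 - yz.1).
  exact: measurable_rV_sub measurable_snd measurable_fst.
have mG E : measurable E -> measurable_fun setT (G E).
  move=> mE; apply/measurable_EFinP; apply: measurable_funM.
    by apply: (measurableT_comp _ measurable_snd); exact: measurable_indic.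
  apply: measurable_funM; first exact: measurableT_comp.
  exact: measurableT_comp mfr measurable_fst.
have convE x : conv x = (\int[mu]_y G setT (y, x))%E.
  by apply: eq_integral => y _; rewrite /G/= indicT mul1r.
have mconv : measurable_fun setT conv.
  rewrite (_ : conv = fubini_G mu (G setT)); last exact/funext.
  by apply: measurable_fun_fubini_tonelli_G => //; exact: mG.
have fsr1 : (\int[mu]_x (fsr x)%:E = 1)%E.
  by rewrite -fsrE// preimage_setT probability_setT.
suff : ae_eq mu setT (EFin \o fsr) conv.
  by apply: filterS => x /(_ I).
apply: integral_ae_eq => //.
  apply/integrableP; split; first exact/measurable_EFinP.
  under eq_integral do rewrite gee0_abs ?lee_fin//.
  by rewrite fsr1 ltry.
move=> E _ mE.
have mindE : measurable_fun setT (EFin \o (\1_E : 'rV[R]_d -> R)).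
  by apply/measurable_EFinP; exact: measurable_indic.
have indE0 (x : 'rV[R]_d) : (0 <= (\1_E x : R)%:E)%E by rewrite lee_fin.
transitivity (\int[P]_w (EFin \o \1_E) (Z (s + r) w))%E.
  rewrite -fsrE//.
  rewrite (_ : (fun w => _) = (fun w => (\1_(Z (s + r) @^-1` E) w)%:E)) //.
  by rewrite integral_indic ?setIT// -[X in measurable X]setTI; exact: mZsr.
have FT : F s setT.
  have [? /(_ set0) + _] := Fs s (ltW s0).
  by rewrite setD0; exact.
rewrite (levy_markov (ltW s0) r0 pr FT mindE indE0).
(* the same integrand in the coordinates (x, y) *)
pose H (xy : 'rV[R]_d * 'rV[R]_d) : \bar R := G E (xy.2, xy.2 + xy.1).
have mH : measurable_fun setT H.
  apply: measurableT_comp; first exact: mG.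
  apply: measurable_fun_pair; first exact: measurable_snd.
  exact: measurable_rV_add measurable_snd measurable_fst.
pose X : {mfun Omega >-> 'rV[R]_d} := mfun_Sub (mem_set mZ).
pose k (x : 'rV[R]_d) : \bar R :=
  (\int[mu]_y ((EFin \o \1_E) (x + y)%R * (fr y)%:E))%E.
have k0 x : (0 <= k x)%E.
  by apply: integral_ge0 => y _; rewrite mule_ge0 ?lee_fin.
have mk : measurable_fun setT k.
  pose K (xy : 'rV[R]_d * 'rV[R]_d) : \bar R :=
    ((EFin \o \1_E) (xy.1 + xy.2)%R * (fr xy.2)%:E)%E.
  rewrite (_ : k = fubini_F mu K); last exact/funext.
  apply: measurable_fun_fubini_tonelli_F.
    apply: emeasurable_funM.
      apply: measurableT_comp => //.
      exact: measurable_rV_add measurable_fst measurable_snd.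
    by apply/measurable_EFinP; exact: measurableT_comp mfr measurable_snd.
  by move=> xy; rewrite mule_ge0 ?lee_fin.
have lawX A : measurable A ->
    distribution P X A = (\int[mu]_(x in A) (fs x)%:E)%E by exact: fsE.
transitivity (\int[distribution P X]_x k x)%E.
  by rewrite ge0_integral_distribution.
rewrite (ge0_integral_density mfs fs0 lawX mk k0).
transitivity (\int[mu]_x \int[mu]_y H (x, y))%E.
  apply: eq_integral => x _; rewrite /k -ge0_integralZr//; last 3 first.
  - apply: emeasurable_funM; last exact/measurable_EFinP.
    apply: measurableT_comp => //.
    by apply: measurable_rV_add => //; exact: measurable_cst.
  - by move=> y _; rewrite mule_ge0 ?lee_fin.
  - by rewrite lee_fin.
  apply: eq_integral => y _.
  rewrite /H/G/= addrAC subrr add0r [y + x]addrC -!EFinM.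
  by rewrite -mulrA [fr y * _]mulrC.
rewrite (fubini_tonelli _ mH) => [|xy]; last exact: G0.
transitivity (\int[mu]_y \int[mu]_z G E (y, z))%E.
  apply: eq_integral => y _.
  rewrite -(ge0_integral_rV_translate y (g := fun z => G E (y, z)))//.
  by apply: measurableT_comp; [exact: mG|exact: measurable_pair1].
rewrite (fubini_tonelli _ (mG _ mE) (G0 E)) [RHS]integral_mkcond.
apply: eq_integral => z _; rewrite patchE; case: ifPn => zE.
  by apply: eq_integral => y _; rewrite /G/= indicE zE mul1r.
by apply: integral0_eq => y _; rewrite /G/= indicE (negbTE zE) mul0r.
Qed.

(** * Expectations of the density along the process *)

Context (p : R -> 'rV[R]_d -> R).
Context (p_density : forall t : R, 0 < t -> has_density P (Z t) (p t)).
Context (p_continuous : forall t : R, 0 < t -> continuous (p t)).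
Context (p_symmetric :
  forall (t : R) (x : 'rV[R]_d), 0 < t -> p t (- x) = p t x).
Context (p_integrable : forall t s : R, 0 < t -> 0 < s ->
  (rV_lebesgue d).-integrable setT (EFin \o (fun x => p t x * p s x))).

(** Symmetry makes the correlation on the right equal to the convolution. *)
Lemma chapman_kolmogorov s r x : 0 < s -> 0 < r ->
  (p (s + r) x)%:E = (\int[rV_lebesgue d]_y (p s (x + y)%R * p r y)%:E)%E.
Proof.
move=> s0 r0; have sr0 : 0 < s + r by exact: addr_gt0.
have [mps ps0 _] := p_density s0; have [mpr pr0 _] := p_density r0.
rewrite (convolution_continuous_version mps mpr ps0 pr0 (p_integrable s0 s0)
  (p_integrable r0 r0) (p_continuous s0) (p_continuous sr0)); last first.
  exact: (chapman_kolmogorov_ae s0 r0 (p_density s0) (p_density r0)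
    (p_density sr0)).
rewrite -[RHS](ge0_integral_rV_reflect 0
  (g := fun y : 'rV[R]_d => (p s (x + y) * p r y)%:E)).
- by apply: eq_integral => y _; rewrite sub0r p_symmetric.
- apply/measurable_EFinP; apply: measurable_funM => //.
  apply: measurableT_comp => //.
  by apply: measurable_rV_add => //; exact: measurable_cst.
- by move=> y; rewrite lee_fin mulr_ge0.
Qed.

Let measurable_density t s : 0 <= t -> 0 < s ->
  measurable_fun setT (EFin \o (fun w => p s (Z t w))).
Proof.
move=> t0 s0; apply/measurable_EFinP; apply: measurableT_comp.
  by have [] := p_density s0.
exact: adapted_measurable.
Qed.

Lemma integral_density_increment t r s A : 0 <= t -> 0 < r -> 0 < s -> F t A ->
  (\int[P]_(w in A) (p s (Z (t + r) w))%:E =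
   \int[P]_(w in A) (p (s + r) (Z t w))%:E)%E.
Proof.
move=> t0 r0 s0 FA; have [mps ps0 _] := p_density s0.
have mpE : measurable_fun setT (EFin \o p s) by exact/measurable_EFinP.
have pE0 x : (0 <= (EFin \o p s) x)%E by rewrite lee_fin.
rewrite (levy_markov t0 r0 (p_density r0) FA mpE pE0).
by apply: eq_integral => w _; rewrite (chapman_kolmogorov _ s0 r0).
Qed.

Let F_setT t : 0 <= t -> F t setT.
Proof.
have [Fs _ _] := F_filtration.
by move=> /Fs[? /(_ set0) + _]; rewrite setD0; exact.
Qed.

(** [Z] starts at the origin, so conditioning at date [0] is no conditioning:
    the expectation of [p s (Z t)] is the value at [Z 0 = 0] of [p (s + t)]. In
    particular it is finite. *)
Lemma expectation_density t s : 0 <= t -> 0 < s ->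
  (\int[P]_w (p s (Z t w))%:E = (p (s + t) 0)%:E)%E.
Proof.
have origin u : 0 < u -> (\int[P]_w (p u (Z 0 w))%:E = (p u 0)%:E)%E.
  move=> u0; have [_ Z0 _ _ _] := Z_levy; have [_ pu0 _] := p_density u0.
  transitivity (\int[P]_w (p u 0)%:E)%E.
    apply: ge0_ae_eq_integral => //.
    - exact: measurable_density.
    - by move=> w _; rewrite lee_fin.
    - by move=> w _; rewrite lee_fin.
    - by apply: filterS Z0 => w /= ->.
  rewrite integral_cst// -[RHS]mule1; congr (_ * _)%E.
  exact: probability_setT.
rewrite le_eqVlt => /predU1P[<-|t0] s0; first by rewrite addr0 origin.
rewrite -[in LHS](add0r t) integral_density_increment//; last exact: F_setT.
by rewrite origin// addr_gt0.
Qed.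

Lemma integrable_density t s : 0 <= t -> 0 < s ->
  P.-integrable setT (EFin \o (fun w => p s (Z t w))).
Proof.
move=> t0 s0; have [_ ps0 _] := p_density s0.
apply/integrableP; split; first exact: measurable_density.
under eq_integral do rewrite /= ger0_norm//.
by rewrite expectation_density// ltry.
Qed.

(** By the preceding formula [p s 0] is the expectation of
    [p (s / 2) (Z (s / 2))], an almost surely positive variable. *)
Lemma density_origin_gt0 s : 0 < s ->
  {ae P, forall w, forall s t : R, 0 < s -> 0 < t -> 0 < p s (Z t w)} ->
  0 < p s 0.
Proof.
move=> s0 ppos; have h0 : 0 < s / 2 by rewrite divr_gt0.
have [_ ps0 _] := p_density s0; have [_ ph0 _] := p_density h0.
rewrite lt_neqAle ps0 andbT; apply/negP => /eqP p0.
have := expectation_density (ltW h0) h0; rewrite -splitr -p0 => int0.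
have [ae0 _] :=
  ae_eq_integral_abs P measurableT (measurable_density (ltW h0) h0).
have null : {ae P, forall w, p (s / 2) (Z (s / 2) w) = 0}.
  suff : ae_eq P setT (EFin \o (fun w => p (s / 2) (Z (s / 2) w))) (cst 0%E).
    by apply: filterS => w /(_ I)[].
  apply: ae0.
  by under eq_integral do rewrite /= ger0_norm//.
have [N [mN N0 sub]] : {ae P, forall w : Omega, False}.
  apply: filterS2 ppos null => w pos pw0.
  by have := pos _ _ h0 h0; rewrite pw0 ltxx.
have PT : P setT = 0%E.
  by apply: (subset_measure0 measurableT mN _ N0) => w _; apply: sub => /=.
have := probability_setT P; rewrite [LHS]PT => /eqP.
by rewrite eq_sym onee_eq0.
Qed.

End levy.

(** * The state price density *)

Theorem theorem3p1 (R : realType) (disp : measure_display)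
  (Omega : measurableType disp) (P : probability Omega R)
  (F : R -> set_system Omega) (d : nat) (Z : R -> Omega -> 'rV[R]_d)
  (p : R -> 'rV[R]_d -> R) (lambda : R -> R)
  (F_filtration : filtration F)
  (Z_levy : levy_process P F Z)
  (p_density : forall t : R, 0 < t -> has_density P (Z t) (p t))
  (* p t is the continuous version of the density, and Z is symmetric *)
  (p_continuous : forall t : R, 0 < t -> continuous (p t))
  (p_symmetric : forall (t : R) (x : 'rV[R]_d), 0 < t -> p t (- x) = p t x)
  (p_positive :
    {ae P, forall w, forall s t : R, 0 < s -> 0 < t -> 0 < p s (Z t w)})
  (p_integrable : forall t s : R, 0 < t -> 0 < s ->
    (rV_lebesgue d).-integrable setT (EFin \o (fun x => p t x * p s x)))
  (lambda_ge0 : forall t : R, 0 <= t -> 0 <= lambda t)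
  (lambda_continuous : {within `[0, +oo[, continuous lambda}) :
  (* the dates at which p (lambda t) is a density *)
  let D := [set t : R | 0 <= t /\ 0 < lambda t] in
  let bond (t T : R) w := p (lambda T + T - t) (Z t w) / p (lambda t) (Z t w) in
  let pi (t : R) w := p (lambda t) (Z t w) in
  arbitrage_free P F D bond /\ state_price_density P F D bond pi.
Proof.
move=> D bond pi.
have [Zad Z0 _ _ _] := Z_levy.
have adapted t s : 0 <= t -> 0 < s ->
    forall B : set R, measurable B -> F t ((fun w => p s (Z t w)) @^-1` B).
  move=> t0 s0 B mB; have [mp _ _] := p_density _ s0.
  apply: (Zad _ t0 (p s @^-1` B)).
  by rewrite -[X in measurable X]setTI; exact: mp.
have integrable t s (t0 : 0 <= t) (s0 : 0 < s) :=
  integrable_density F_filtration Z_levy p_density p_continuous p_symmetric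
    p_integrable t0 s0.
have origin s (s0 : 0 < s) := density_origin_gt0 F_filtration Z_levy p_density
  p_continuous p_symmetric p_integrable s0 p_positive.
suff spd : state_price_density P F D bond pi by split=> //; exists pi.
split.
- by move=> t [t0 lt0]; exact: adapted.
- apply: filterS2 p_positive Z0 => w pos Z0w t [t0 lt0]; rewrite /pi.
  move: t0 lt0; rewrite le_eqVlt => /predU1P[<-|t0] lt0; last exact: pos.
  by rewrite Z0w origin.
- move=> t T [t0 lt0] [T0 lT0] tT; split; first exact: integrable.
  have s0 : 0 < lambda T + T - t by rewrite -addrA ltr_wpDr// subr_ge0.
  exists (fun w => p (lambda T + T - t) (Z t w)); last first.
    by apply: aeW => w; rewrite /bond /pi mulrC.
  split; [exact: adapted|exact: integrable|move=> A FA].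
  move: tT; rewrite le_eqVlt => /predU1P[->|tT]; first by rewrite addrK.
  rewrite -subr_gt0 in tT.
  have := integral_density_increment F_filtration Z_levy p_density
    p_continuous p_symmetric p_integrable t0 tT lT0 FA.
  by rewrite [t + _]addrC subrK addrA => ->.
Qed.
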